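(* Let $L\ge 1$ and $M\ge 3$ be integers, and let $n(t)$, $t=0,\dots,LM-1$, be an i.i.d. sequence of real Gaussian random variables with mean zero and variance $\sigma^2$, divided into $M$ windows of length $L$. Let $f\in\{0,\dots,L-1\}$ with $f\neq 0$ and $f\neq L/2$, and let $P_n=P_n(f)$ be the cross-correlation periodogram of $n$ at frequency $f$. Then: (a) $\mathbb{E}(P_n)=0$; (b) $\mathrm{Var}(P_n)=\dfrac{\sigma^4}{2M}$; (c) $\mathbb{E}|P_n|\le \dfrac{\sigma^2}{\sqrt{2M}}$.
   Context: The $m$-th window of the noise is $n_m(t):=n(mL+t)$ for $t=0,\dots,L-1$ and $m=0,\dots,M-1$, and its normalized discrete Fourier transform is $N_m(f)=\frac{1}{\sqrt{L}}\sum_{t=0}^{L-1} n_m(t)e^{-2\pi i f t/L}$, $f=0,\dots,L-1$. The cross-correlation periodogram of $n$ is $P_n(f)=\frac1M\sum_{m=0}^{M-1}\mathrm{Re}\big[N_m(f)\,N_{m+1}(f)^*\big]$, where $*$ denotes complex conjugation and window indices are taken modulo $M$ (so $N_M=N_0$). Here $\sigma=\sqrt{\sigma^2}\ge 0$. *)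

(* Defs.v *)
From HB Require Import structures.
From mathcomp Require Export all_boot all_order all_algebra.
From mathcomp Require Export complex.
From mathcomp Require Export all_classical all_reals all_analysis.

Set Implicit Arguments.
Unset Strict Implicit.
Unset Printing Implicit Defensive.

Import Order.TTheory GRing.Theory Num.Theory.

Local Open Scope classical_set_scope.
Local Open Scope ring_scope.

(* The law N(m, s^2) on R, s >= 0 being the standard deviation.  The library's
   [normal_prob m s] agrees with it for s > 0, but is by convention the uniform
   law on [0, 1] when s = 0; the degenerate law N(m, 0) is the Dirac mass at m. *)
Definition gaussian_law (R : realType) (m s : R) (A : set R) : \bar R :=
  if s == 0 then \d_m A else normal_prob m s A.

Definition mutually_independent (d : measure_display) (T : measurableType d)
    (R : realType) (P : probability T R) (I : finType)
    (X : I -> {RV P >-> R}) : Prop :=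
  forall (J : {set I}) (A : I -> set R),
    (forall i, i \in J -> measurable (A i)) ->
    P [set w | forall i, i \in J -> A i (X i w)] =
    (\prod_(i in J) P (X i @^-1` A i))%E.

Arguments mutually_independent {d T R} P {I} X.

Definition iid_gaussian (d : measure_display) (T : measurableType d)
    (R : realType) (P : probability T R) (I : finType)
    (X : I -> {RV P >-> R}) (m s : R) : Prop :=
  mutually_independent P X /\
  forall i (A : set R), measurable A ->
    distribution P (X i) A = gaussian_law m s A.

Arguments iid_gaussian {d T R} P {I} X m s.

(* e^{i theta}, by Euler's formula. *)
Definition expi (R : realType) (theta : R) : R[i] :=
  (cos theta +i* sin theta)%C.

Lemma window_index_lt (L M : nat) (m : 'I_M) (t : 'I_L) : (m * L + t < L * M)%N.
Proof.
have h : (m.+1 * L <= M * L)%N by rewrite leq_mul2r ltn_ord orbT.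
by rewrite (mulnC L M) (leq_trans _ h)// mulSn addnC ltn_add2r.
Qed.

Definition window (R : realType) (L M : nat) (x : 'I_(L * M) -> R)
    (m : 'I_M) (t : 'I_L) : R :=
  x (Ordinal (window_index_lt m t)).

Definition window_dft (R : realType) (L M : nat) (x : 'I_(L * M) -> R)
    (m : 'I_M) (f : 'I_L) : R[i] :=
  ((Num.sqrt L%:R)^-1)%:C%C *
  \sum_(t < L) (window x m t)%:C%C * expi (- (2 * pi * f%:R * t%:R / L%:R)).

(* [ordS m] is m + 1 modulo M. *)
Definition periodogram (R : realType) (L M : nat) (x : 'I_(L * M) -> R)
    (f : 'I_L) : R :=
  M%:R^-1 * \sum_(m < M)
    complex.Re (window_dft x m f * (window_dft x (ordS m) f)^*%C).

(* Main.v *)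
Require Import Defs.
From mathcomp Require Import measurable_realfun ring lra zify.
Import Order.TTheory GRing.Theory Num.Theory.
Import numFieldNormedType.Exports HBNNSimple.
Local Open Scope classical_set_scope.
Local Open Scope ring_scope.

(** Expanding the two transforms turns the periodogram into a quadratic form

      [P_n = \sum_(m, s, t) b(m, s, t) * n_m(s) * n_(m+1)(t)],
      [b(m, s, t) = cos (theta_s - theta_t) / (M L)],
      [theta_t = 2 pi f t / L].

    Each term is a monomial [X_S], the product of the noise samples whose index
    lies in the two-element set [S] made of the samples [(m, s)] and
    [(m + 1, t)].  Because [M >= 3], distinct triples [(m, s, t)] give distinct
    sets: adjacent windows differ, and the step from window [m] to [m + 1]
    cannot be confused with the step back from [m + 1] to [m], as it could for
    [M = 2] ([sample_pair_inj]).

    For independent centred variables of variance [v] the monomials are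
    orthogonal: [E (X_S X_S')] factors over the indices, every index belonging
    to exactly one of [S], [S'] contributes a factor [E X_i = 0], and each index
    belonging to both contributes [v] ([monomial_moments]).  Hence [E P_n = 0],
    and [Var P_n] is a sum of squares ([monomial_sum_moments]):

      [Var P_n = sigma^4 \sum b^2
               = sigma^4 / (M L)^2 * M * \sum_(s, t) cos^2 (theta_s - theta_t)].

    Writing [cos^2 x = (1 + cos (2 x)) / 2], the double sum is [L^2 / 2], as
    the oscillating part sums to zero over a full period when [f] is neither [0]
    nor [L / 2] ([sum_sqr_cos_phase]).  This gives [sigma^4 / (2 M)], and the
    bound on [E |P_n|] is the comparison of the [L^1] and [L^2] norms.

    Gaussianity enters only through the mean and the variance of the samples
    ([gaussian_moments]).  The analytic substance is that expectations of
    products of independent variables factor.  This is obtained by replacing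
    indicator functions by general ones, one variable at a time: freezing all
    the other factors into a weight [W], the product rule says that two measures
    on the line agree on all Borel sets, so the integrals of any nonnegative
    function against them agree too ([weighted_change_of_variables]). *)

(** * Integrals of products of independent variables *)

(** If [nu] is the image under [X] of the measure of density [W], integrals
    against [nu] can be pulled back.  The hypothesis is the case of indicator
    functions; simple functions follow by linearity and all nonnegative ones by
    monotone convergence.  Densities are covered by [X] the identity, and
    independence by [W] the product of the other factors. *)
Lemma weighted_change_of_variables d1 d2 (T1 : measurableType d1)
    (T2 : measurableType d2) (R : realType)
    (mu : {measure set T1 -> \bar R}) (nu : {measure set T2 -> \bar R})
    (X : T1 -> T2) (W : T1 -> \bar R) (g : T2 -> \bar R) :
  measurable_fun setT X -> measurable_fun setT W -> (forall x, (0 <= W x)%E) ->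
  (forall x, W x \is a fin_num) ->
  (forall A, measurable A -> (\int[mu]_(x in X @^-1` A) W x = nu A)%E) ->
  measurable_fun setT g -> (forall y, (0 <= g y)%E) ->
  (\int[mu]_x (g (X x) * W x) = \int[nu]_y g y)%E.
Proof.
move=> mX mW W0 Wfin WX mg g0.
pose h := nnsfun_approx measurableT mg.
have hg y : EFin \o h^~ y @ \oo --> g y by exact: cvg_nnsfun_approx.
have ndh y : {homo (fun n => h n y) : m n / (m <= n)%N >-> m <= n}.
  by move=> m n mn; exact/lefP/nd_nnsfun_approx.
have mhX n : measurable_fun setT (fun x => (h n (X x))%:E).
  by apply/measurable_EFinP; exact: measurableT_comp.
have -> : (\int[nu]_y g y = lim (\int[nu]_y (h n y)%:E @[n --> \oo]))%E.
  transitivity (\int[nu]_y lim ((h n y)%:E @[n --> \oo]))%E.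
    by apply: eq_integral => y _; apply/esym/cvg_lim => //; exact: hg.
  apply: monotone_convergence => //.
  - by move=> n; apply/measurable_EFinP; exact: measurable_funP.
  - by move=> n x _; rewrite lee_fin.
  - by move=> y _ m n mn; rewrite lee_fin ndh.
have -> : (\int[mu]_x (g (X x) * W x) =
    lim (\int[mu]_x ((h n (X x))%:E * W x) @[n --> \oo]))%E.
  transitivity (\int[mu]_x lim ((h n (X x))%:E * W x @[n --> \oo])%E)%E.
    apply: eq_integral => x _; apply/esym/cvg_lim => //.
    by apply: cvgeZr; [exact: Wfin|exact: hg].
  apply: monotone_convergence => //.
  - by move=> n; exact: emeasurable_funM.
  - by move=> n x _; rewrite mule_ge0 ?lee_fin.
  - by move=> x _ m n mn; rewrite lee_wpmul2r// lee_fin ndh.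
suff E n : (\int[mu]_x ((h n (X x))%:E * W x) = \int[nu]_y (h n y)%:E)%E.
  by under eq_fun do rewrite E.
rewrite integralT_nnsfun sintegralE.
transitivity (\int[mu]_x (\sum_(y \in range (h n))
    (y * \1_(h n @^-1` [set y]) (X x))%:E * W x))%E.
  apply: eq_integral => x _.
  rewrite -ge0_mule_fsuml => [|y]; last exact: nnfun_muleindic_ge0.
  by rewrite fsumEFin // -(fimfunE _ (X x)).
rewrite ge0_integral_fsum//; last 2 first.
  - move=> y; apply: emeasurable_funM => //; apply/measurable_EFinP.
    apply: measurable_funM => //; apply: measurableT_comp => //.
  - by move=> m y Ey; rewrite mule_ge0 ?W0// nnfun_muleindic_ge0.
apply: eq_fsbigr => r rhn.
under eq_integral do rewrite EFinM -muleA.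
rewrite ge0_integralZl//.
- congr (_ * _)%E.
  rewrite -WX; last exact: measurable_sfunP.
  rewrite [RHS]integral_mkcond; apply: eq_integral => x _.
  rewrite epatch_indic muleC//.
- apply: emeasurable_funM => //; apply/measurable_EFinP.
  by apply: measurableT_comp => //.
- by move=> t _; rewrite mule_ge0 ?lee_fin.
- by move: rhn; rewrite inE => -[t _ <-]; rewrite lee_fin.
Qed.

Lemma measurable_prod_comp d (T : measurableType d) (R : realType)
    (P : probability T R) (I : finType) (X : I -> {RV P >-> R})
    (g : I -> R -> R) (p : pred I) :
  (forall i, measurable_fun setT (g i)) ->
  measurable_fun setT (fun w => \prod_(i | p i) g i (X i w)).
Proof.
move=> mg; under eq_fun do rewrite -big_filter.
apply: measurable_prod => i _.
exact: measurableT_comp.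
Qed.

Lemma prod_EFin (R : realType) (I : finType) (p : pred I) (u : I -> R) :
  (\prod_(i | p i) (u i)%:E)%E = (\prod_(i | p i) u i)%:E.
Proof. by apply/esym/(big_morph EFin) => // x y; rewrite EFinM. Qed.

Lemma integral_indic_comp d (T : measurableType d) (R : realType)
    (P : probability T R) (X : {RV P >-> R}) (A : set R) : measurable A ->
  (\int[P]_w (\1_A (X w))%:E = P (X @^-1` A))%E.
Proof.
move=> mA; have mXA : measurable (X @^-1` A).
  by rewrite -[X in measurable X]setTI; apply: measurable_funPT.
by rewrite -[in RHS](setIT (_ @^-1` _)) -integral_indic.
Qed.

(** The induction is on the list of indices whose factor is allowed to be an
    arbitrary function, the others being indicators: the base case is the
    definition of independence, and the inductive step is a change of variables
    weighted by the remaining factors. *)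
Lemma ge0_independent_integral_prod d (T : measurableType d) (R : realType)
    (P : probability T R) (I : finType) (X : I -> {RV P >-> R})
    (g : I -> R -> R) :
  mutually_independent P X -> (forall i, measurable_fun setT (g i)) ->
  (forall i x, 0 <= g i x) ->
  (forall i, (\int[P]_w (g i (X i w))%:E < +oo)%E) ->
  (\int[P]_w (\prod_i g i (X i w))%:E = \prod_i \int[P]_w (g i (X i w))%:E)%E.
Proof.
move=> indX.
suff: forall s : seq I, forall g : I -> R -> R,
  (forall i, measurable_fun setT (g i)) -> (forall i x, 0 <= g i x) ->
  (forall i, (\int[P]_w (g i (X i w))%:E < +oo)%E) ->
  (forall i, i \notin s -> exists2 A, measurable A & g i = \1_A) ->
  (\int[P]_w (\prod_i g i (X i w))%:E = \prod_i \int[P]_w (g i (X i w))%:E)%E.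
  move=> H mg g0 gfin; apply: (H (enum I)) => // i.
  by rewrite mem_enum.
elim=> [|i s IH] {}g mg g0 gfin gs.
  have /choice[A HA] : forall i, exists A, measurable A /\ g i = \1_A.
    by move=> i; have [//|A mA gA] := gs i; exists A.
  have mXA i : measurable (X i @^-1` A i).
    by rewrite -[X in measurable X]setTI; apply: measurable_funPT => //; apply: (HA i).1.
  have -> : (\prod_i \int[P]_w (g i (X i w))%:E = \prod_i P (X i @^-1` A i))%E.
    apply: eq_bigr => i _; rewrite (HA i).2 integral_indic_comp//.
    exact: (HA i).1.
  have := indX [set: I]%SET A (fun i _ => (HA i).1).
  under [in RHS]eq_bigl do rewrite inE.
  move=> <-.
  have -> : [set w | forall i, i \in [set: I]%SET -> A i (X i w)] =
     \bigcap_(i in setT) (X i @^-1` A i).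
    by apply/seteqP; split=> w /= H i; [move=> _|move=> _]; apply: H => //; rewrite inE.
  set B := \bigcap_(i in _) _.
  have mB : measurable B.
    by apply: fin_bigcap_measurable => //; exact: finite_finset.
  rewrite -(setIT B) -integral_indic//.
  apply: eq_integral => w _; congr EFin.
  under eq_bigr => i _ do rewrite (HA i).2.
  rewrite indicE; case: (boolP (w \in B)).
    rewrite inE => Bw; rewrite big1// => i _; rewrite indicE mem_set//.
    exact: Bw.
  move=> /negP wB.
  have [i nAi] : exists i, ~ A i (X i w).
    by apply/existsNP => H; apply: wB; rewrite inE => i _; exact: H.
  by rewrite (bigD1 i)//= indicE memNset// mul0r.
(* the factor i is freed, all the others being frozen into the weight *)
pose W w := \prod_(j | j != i) g j (X j w).
have W0 w : 0 <= W w by apply: prodr_ge0.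
pose c := \prod_(j | j != i) fine (\int[P]_w (g j (X j w))%:E)%E.
have c0 : 0 <= c.
  by apply: prodr_ge0 => j _; apply/fine_ge0/integral_ge0 => w _; rewrite lee_fin.
have cE : c%:E = (\prod_(j | j != i) \int[P]_w (g j (X j w))%:E)%E.
  rewrite -prod_EFin; apply: eq_bigr => j _; rewrite fineK// ge0_fin_numE//.
  by apply: integral_ge0 => w _; rewrite lee_fin.
pose nu := mscale (NngNum c0) (distribution P (X i)).
have Wnu A : measurable A -> (\int[P]_(w in X i @^-1` A) (W w)%:E = nu A)%E.
  move=> mA.
  have mXA : measurable (X i @^-1` A).
    by rewrite -[X in measurable X]setTI; apply: measurable_funPT.
  pose g' := fun j => if j == i then \1_A else g j.
  have -> : (nu A = \prod_j \int[P]_w (g' j (X j w))%:E)%E.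
    rewrite (bigD1 i)//= /g' eqxx /nu /= /mscale/= muleC; congr (_ * _)%E.
      by rewrite integral_indic_comp.
    by rewrite cE; apply: eq_bigr => j /negbTE ->.
  rewrite -IH.
  - rewrite integral_mkcond; apply: eq_integral => w _.
    rewrite epatch_indic/= (bigD1 i)//= /g' eqxx -EFinM mulrC.
    congr (_ * _)%:E; apply: eq_bigr => j /negbTE -> //.
  - move=> j; rewrite /g'; case: ifP => // _; exact: measurable_indic.
  - by move=> j x; rewrite /g'; case: ifP.
  - move=> j; rewrite /g'; case: eqP => // ->.
    by rewrite integral_indic_comp// (le_lt_trans (probability_le1 _ _)) ?ltry.
  - move=> j js; rewrite /g'; case: eqP => [_|/eqP ji]; first by exists A.
    by apply: gs; rewrite inE negb_or ji.
have := @weighted_change_of_variables _ _ _ _ R P nu (X i)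
  (fun w => (W w)%:E) (fun x => (g i x)%:E).
under eq_integral => w _.
  rewrite -EFinM (_ : g i (X i w) * W w = \prod_i g i (X i w)); last first.
    by rewrite [RHS](bigD1 i).
  over.
move=> ->//.
- rewrite ge0_integral_mscale//=; last 2 first.
    exact/measurable_EFinP.
    by move=> x _; rewrite lee_fin.
  rewrite ge0_integral_distribution//=; last 2 first.
    exact/measurable_EFinP.
    by move=> x; rewrite lee_fin.
  by rewrite [RHS](bigD1 i)//= -cE muleC.
- by apply/measurable_EFinP/measurable_prod_comp.
- exact/measurable_EFinP.
- by move=> y; rewrite lee_fin.
Qed.

Lemma integrable_independent_prod d (T : measurableType d) (R : realType)
    (P : probability T R) (I : finType) (X : I -> {RV P >-> R})
    (g : I -> R -> R) :
  mutually_independent P X -> (forall i, measurable_fun setT (g i)) ->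
  (forall i, P.-integrable setT (fun w => (g i (X i w))%:E)) ->
  P.-integrable setT (fun w => (\prod_i g i (X i w))%:E).
Proof.
move=> indX mg ig; apply/integrableP; split.
  by apply/measurable_EFinP; exact: measurable_prod_comp.
have fin i : (\int[P]_w (`|g i (X i w)|)%:E < +oo)%E.
  by have /integrableP[_] := ig i.
under eq_integral do rewrite abse_EFin normr_prod.
rewrite (@ge0_independent_integral_prod _ _ _ _ _ X (fun i x => `|g i x|))//.
  have fin' i : (\int[P]_w (`|g i (X i w)|)%:E)%E \is a fin_num.
    by rewrite ge0_fin_numE//; apply: integral_ge0 => w _; rewrite lee_fin.
  under eq_bigr => i _ do rewrite -(fineK (fin' i)).
  by rewrite prod_EFin ltry.
by move=> i; exact: measurableT_comp.
Qed.

(** The same induction as for nonnegative factors removes the sign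
    condition from one factor at a time: both sides are additive in the [i]-th
    factor, which is split into its positive and negative parts. *)
Lemma independent_integral_prod d (T : measurableType d) (R : realType)
    (P : probability T R) (I : finType) (X : I -> {RV P >-> R})
    (g : I -> R -> R) :
  mutually_independent P X -> (forall i, measurable_fun setT (g i)) ->
  (forall i, P.-integrable setT (fun w => (g i (X i w))%:E)) ->
  (\int[P]_w (\prod_i g i (X i w))%:E = \prod_i \int[P]_w (g i (X i w))%:E)%E.
Proof.
move=> indX.
suff: forall s : seq I, forall g : I -> R -> R,
  (forall i, measurable_fun setT (g i)) ->
  (forall i, P.-integrable setT (fun w => (g i (X i w))%:E)) ->
  (forall i, i \notin s -> forall x, 0 <= g i x) ->
  (\int[P]_w (\prod_i g i (X i w))%:E = \prod_i \int[P]_w (g i (X i w))%:E)%E.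
  move=> H mg ig; apply: (H (enum I)) => // i.
  by rewrite mem_enum.
elim=> [|i s IH] {}g mg ig gs.
  apply: ge0_independent_integral_prod => // [i|i]; first exact: gs.
  have /integrableP[_] := ig i; apply: le_lt_trans.
  apply: ge0_le_integral => //=.
  - by move=> w _; rewrite lee_fin gs.
  - by have /integrableP[] := ig i.
  - by apply/measurable_EFinP/measurableT_comp => //; exact: measurableT_comp.
  - by move=> w _; rewrite lee_fin ler_norm.
pose upd h := fun j => if j == i then h else g j : R -> R.
have updE h : (fun w => \prod_j upd h j (X j w)) =
    (fun w => h (X i w) * \prod_(j | j != i) g j (X j w)).
  apply/funext => w; rewrite (bigD1 i)//= /upd eqxx; congr (_ * _).
  by apply: eq_bigr => j /negbTE ->.
have mupd h : measurable_fun setT h -> forall j, measurable_fun setT (upd h j).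
  by move=> mh j; rewrite /upd; case: ifP.
have iupd h : P.-integrable setT (fun w => (h (X i w))%:E) ->
    forall j, P.-integrable setT (fun w => (upd h j (X j w))%:E).
  by move=> ih j; rewrite /upd; case: eqP => [->|_] //.
pose gp x := Num.max (g i x) 0; pose gn x := Num.max (- g i x) 0.
have gpn x : g i x = gp x - gn x.
  rewrite /gp /gn; case: (leP (g i x) 0) => gx.
    by rewrite max_l ?oppr_ge0// sub0r opprK.
  by rewrite max_r ?subr0// oppr_le0 ltW.
have mgp : measurable_fun setT gp by exact: measurable_maxr.
have mgn : measurable_fun setT gn by apply: measurable_maxr => //; exact: measurableT_comp.
have le_gp x : `|gp x| <= `|g i x|.
  by rewrite /gp; case: (leP (g i x) 0) => gx//; rewrite normr0.
have le_gn x : `|gn x| <= `|g i x|.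
  by rewrite /gn; case: (leP (- g i x) 0) => gx; rewrite ?normr0// normrN.
have igp : P.-integrable setT (fun w => (gp (X i w))%:E).
  apply: (le_integrable _ _ _ (ig i)) => //.
    by apply/measurable_EFinP; exact: measurableT_comp.
  by move=> w _; rewrite lee_fin.
have ign : P.-integrable setT (fun w => (gn (X i w))%:E).
  apply: (le_integrable _ _ _ (ig i)) => //.
    by apply/measurable_EFinP; exact: measurableT_comp.
  by move=> w _; rewrite lee_fin.
have E h : measurable_fun setT h ->
    P.-integrable setT (fun w => (h (X i w))%:E) -> (forall x, 0 <= h x) ->
    (\int[P]_w (\prod_j upd h j (X j w))%:E =
     \int[P]_w (h (X i w))%:E * \prod_(j | j != i) \int[P]_w (g j (X j w))%:E)%E.
  move=> mh ih h0; rewrite (IH (upd h)).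
  - rewrite (bigD1 i)//= /upd eqxx; congr (_ * _)%E.
    by apply: eq_bigr => j /negbTE ->.
  - exact: mupd.
  - exact: iupd.
  - move=> j js x; rewrite /upd; case: eqP => [//|/eqP ji].
    by apply: gs; rewrite inE negb_or ji.
have -> : (fun w => (\prod_j g j (X j w))%:E) =
    (fun w => (\prod_j upd gp j (X j w))%:E - (\prod_j upd gn j (X j w))%:E)%E.
  apply/funext => w; rewrite -EFinB; congr EFin.
  have /(congr1 (@^~ w)) /= -> := updE gp.
  have /(congr1 (@^~ w)) /= -> := updE gn.
  by rewrite -mulrBl -gpn (bigD1 i).
rewrite integralB_EFin//; [|exact: integrable_independent_prod (mupd _ mgp) (iupd _ igp)
  |exact: integrable_independent_prod (mupd _ mgn) (iupd _ ign)].
rewrite !E//; [|by move=> x; rewrite le_max lexx orbT..].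
have fin j : (\int[P]_w (g j (X j w))%:E)%E \is a fin_num by exact: integrable_fin_num.
rewrite [RHS](bigD1 i)//=.
under eq_bigr => j _ do rewrite -(fineK (fin j)).
rewrite prod_EFin -muleBl//; last by rewrite fin_num_adde_defl// fin_numN integrable_fin_num.
rewrite -integralB_EFin//; congr (_ * _)%E.
by apply: eq_integral => w _; rewrite -EFinB -gpn.
Qed.

Lemma integrable_of_sqr d (T : measurableType d) (R : realType)
    (P : probability T R) (X : T -> R) :
  measurable_fun setT X -> P.-integrable setT (fun w => (X w ^+ 2)%:E) ->
  P.-integrable setT (fun w => (X w)%:E).
Proof.
move=> mX iX2.
have i1 : P.-integrable setT (fun w => (X w ^+ 2 + 1)%:E).
  under eq_fun do rewrite EFinD.
  by apply: integrableD => //; exact: finite_measure_integrable_cst.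
apply: (le_integrable _ _ _ i1) => //=; first exact/measurable_EFinP.
move=> w _; rewrite lee_fin.
rewrite [leRHS]ger0_norm ?addr_ge0 ?sqr_ge0// -real_normK ?num_real//.
have := sqr_ge0 (`|X w| - 1); have := normr_ge0 (X w); nra.
Qed.

(** The product of two monomials is [\prod_i X_i ^+ e_i] with exponents [0], [1]
    or [2], so that second moments suffice for integrability and a single
    exponent [1] makes the expectation vanish. *)
Lemma monomial_moments d (T : measurableType d) (R : realType)
    (P : probability T R) (I : finType) (X : I -> {RV P >-> R}) (v : R) :
  mutually_independent P X ->
  (forall i, P.-integrable setT (fun w => (X i w ^+ 2)%:E)) ->
  (forall i, (\int[P]_w (X i w)%:E = 0)%E) ->
  (forall i, (\int[P]_w (X i w ^+ 2)%:E = v%:E)%E) ->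
  forall S S' : {set I},
  P.-integrable setT
    (fun w => ((\prod_(i in S) X i w) * (\prod_(i in S') X i w))%:E) /\
  (\int[P]_w ((\prod_(i in S) X i w) * (\prod_(i in S') X i w))%:E =
   (v ^+ #|S| *+ (S == S'))%:E)%E.
Proof.
move=> indX iX2 EX EX2 S S'.
have iX1 i : P.-integrable setT (fun w => (X i w)%:E) by exact: integrable_of_sqr.
pose e i := ((i \in S) + (i \in S'))%N.
have prodE w : (\prod_(i in S) X i w) * (\prod_(i in S') X i w) = \prod_i X i w ^+ e i.
  rewrite (big_mkcond (mem S)) (big_mkcond (mem S')) -big_split/=.
  apply: eq_bigr => i _; rewrite /e.
  by case: (i \in S); case: (i \in S'); rewrite ?mulr1 ?mul1r ?expr0 ?expr1 ?expr2.
have ie i : P.-integrable setT (fun w => (X i w ^+ e i)%:E).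
  rewrite /e; case: (i \in S); case: (i \in S'); rewrite /= ?(addn0, add0n).
  - exact: iX2.
  - exact: iX1.
  - exact: iX1.
  - by under eq_fun do rewrite expr0; exact: finite_measure_integrable_cst.
have Ee i : (\int[P]_w (X i w ^+ e i)%:E =
    (if i \in S then (if i \in S' then v else 0) else (if i \in S' then 0 else 1))%:E)%E.
  rewrite /e; case: (i \in S); case: (i \in S'); rewrite /= ?(addn0, add0n).
  - exact: EX2.
  - exact: EX.
  - exact: EX.
  under eq_integral do rewrite expr0.
  by rewrite integral_cst//= probability_setT mule1.
have me i : measurable_fun setT (fun x : R => x ^+ e i) by exact: measurable_funX.
under eq_fun do rewrite prodE.
split; first exact: (@integrable_independent_prod _ _ _ _ _ X (fun i x => x ^+ e i)).
rewrite (@independent_integral_prod _ _ _ _ _ X (fun i x => x ^+ e i))//.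
under eq_bigr do rewrite Ee.
rewrite prod_EFin; congr EFin.
case: eqP => [<-|/eqP nS].
  rewrite -prodr_const (big_mkcond (mem S))/=.
  by rewrite mulr1n; apply: eq_bigr => i _; case: (i \in S).
(* an index of the symmetric difference carries the exponent 1 *)
have [i iSS'] : exists i, (i \in S) != (i \in S').
  apply/existsP; apply: contraNT nS => /existsPn H; apply/eqP/setP => i.
  by apply/eqP; rewrite -[_ == _]negbK.
by rewrite (bigD1 i)//=; move: iSS'; case: (i \in S); case: (i \in S') => // _; rewrite mul0r.
Qed.

Lemma integral_sumEFin d (T : measurableType d) (R : realType)
    (P : probability T R) (K : finType) (h : K -> T -> R) :
  (forall p, P.-integrable setT (fun w => (h p w)%:E)) ->
  P.-integrable setT (fun w => (\sum_p h p w)%:E) /\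
  (\int[P]_w (\sum_p h p w)%:E = \sum_p \int[P]_w (h p w)%:E)%E.
Proof.
move=> ih.
under eq_fun do rewrite -sumEFin.
split; first by apply: integrable_sum.
by rewrite integral_sum.
Qed.

(** Parseval's identity for the orthogonal monomials.  The mean is the
    correlation with the empty monomial, which is the constant [1]. *)
Lemma monomial_sum_moments d (T : measurableType d) (R : realType)
    (P : probability T R) (I K : finType) (X : I -> {RV P >-> R}) (v : R)
    (b : K -> R) (S : K -> {set I}) :
  mutually_independent P X ->
  (forall i, P.-integrable setT (fun w => (X i w ^+ 2)%:E)) ->
  (forall i, (\int[P]_w (X i w)%:E = 0)%E) ->
  (forall i, (\int[P]_w (X i w ^+ 2)%:E = v%:E)%E) ->
  injective S -> (forall p, S p != finset.set0) ->
  let Q w := \sum_p b p * \prod_(i in S p) X i w in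
  [/\ (\int[P]_w (Q w)%:E = 0)%E,
      P.-integrable setT (fun w => (Q w ^+ 2)%:E) &
      (\int[P]_w (Q w ^+ 2)%:E = (\sum_p b p ^+ 2 * v ^+ #|S p|)%:E)%E].
Proof.
move=> indX iX2 EX EX2 injS S0 Q.
pose Y p w := \prod_(i in S p) X i w.
have mom := @monomial_moments _ _ _ _ _ _ _ indX iX2 EX EX2.
have Y1 p : P.-integrable setT (fun w => (b p * Y p w)%:E) /\
    (\int[P]_w (b p * Y p w)%:E = 0)%E.
  have [iY EY] := mom (S p) finset.set0.
  move: iY EY; under eq_fun do rewrite finset.big_set0 mulr1.
  rewrite (negbTE (S0 p)) mulr0n => iY EY.
  under eq_fun do rewrite EFinM.
  by split; [exact: integrableZl|rewrite integralZl// EY mule0].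
have Y2 pq : P.-integrable setT (fun w => (b pq.1 * b pq.2 * (Y pq.1 w * Y pq.2 w))%:E) /\
    (\int[P]_w (b pq.1 * b pq.2 * (Y pq.1 w * Y pq.2 w))%:E =
      (b pq.1 * b pq.2 * (v ^+ #|S pq.1| *+ (pq.1 == pq.2)))%:E)%E.
  have [iY EY] := mom (S pq.1) (S pq.2).
  under eq_fun do rewrite EFinM.
  split; first exact: integrableZl.
  by rewrite integralZl// EY (inj_eq injS) -EFinM.
have Q2 w : Q w ^+ 2 = \sum_(pq : K * K) b pq.1 * b pq.2 * (Y pq.1 w * Y pq.2 w).
  rewrite expr2 /Q mulr_suml -(pair_bigA _ (fun p q => b p * b q * (Y p w * Y q w)))/=.
  apply: eq_bigr => p _; rewrite mulr_sumr; apply: eq_bigr => q _.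
  by rewrite mulrACA.
have [_ EQ] := @integral_sumEFin _ _ _ _ _ _ (fun p => (Y1 p).1).
have [iQ2 EQ2] := @integral_sumEFin _ _ _ _ _ _ (fun pq => (Y2 pq).1).
split.
- by rewrite EQ big1// => p _; exact: (Y1 p).2.
- by under eq_fun do rewrite Q2.
- under eq_integral do rewrite Q2.
  rewrite EQ2; under eq_bigr do rewrite (Y2 _).2.
  rewrite sumEFin; congr EFin.
  rewrite -(pair_bigA _ (fun p q => b p * b q * (v ^+ #|S p| *+ (p == q))))/=.
  apply: eq_bigr => p _; rewrite (bigD1 p)//= eqxx mulr1n big1 ?addr0 ?expr2//.
  by move=> q /negbTE; rewrite eq_sym => ->; rewrite mulr0n mulr0.
Qed.

(** With [a] the mean of [|Q|], the variance [E (|Q| - a)^2 = c^2 - a^2] is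
    nonnegative. *)
Lemma L1_le_L2 d (T : measurableType d) (R : realType)
    (P : probability T R) (Q : T -> R) (c : R) :
  measurable_fun setT Q -> P.-integrable setT (fun w => (Q w ^+ 2)%:E) ->
  0 <= c -> (\int[P]_w (Q w ^+ 2)%:E = (c ^+ 2)%:E)%E ->
  (\int[P]_w `|Q w|%:E <= c%:E)%E.
Proof.
move=> mQ iQ2 c0 EQ2.
have iQ : P.-integrable setT (fun w => `|Q w|%:E).
  apply: integrable_of_sqr; first exact: measurableT_comp.
  by under eq_fun do rewrite real_normK ?num_real//.
have fQ := integrable_fin_num measurableT iQ.
set a := fine (\int[P]_w `|Q w|%:E)%E.
have aE : (\int[P]_w `|Q w|%:E = a%:E)%E by rewrite fineK.
rewrite aE lee_fin.
have : (0 <= \int[P]_w ((`|Q w| - a) ^+ 2)%:E)%E.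
  by apply: integral_ge0 => w _; rewrite lee_fin sqr_ge0.
have -> : (fun w => ((`|Q w| - a) ^+ 2)%:E) =
    (fun w => (Q w ^+ 2 + a ^+ 2)%:E - ((2 * a)%:E * `|Q w|%:E))%E.
  apply/funext => w; rewrite -EFinM -EFinB; congr EFin.
  by rewrite -(real_normK (num_real (Q w))); ring.
have i1 : P.-integrable setT (fun w => (Q w ^+ 2 + a ^+ 2)%:E).
  under eq_fun do rewrite EFinD.
  by apply: integrableD => //; exact: finite_measure_integrable_cst.
rewrite integralB//; last exact: integrableZl.
rewrite integralZl// aE.
under eq_integral do rewrite EFinD.
rewrite integralD//; last exact: finite_measure_integrable_cst.
rewrite EQ2 integral_cst//= probability_setT mule1 -EFinD -?EFinM lee_fin.
move=> h; nra.
Qed.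

(** * Moments of the normal law *)

(** The measure [nu] lives on the type [R], whose sigma-algebra carries another
    display than the type on which [lebesgue_measure] and [normal_prob] are
    defined; the change of variables along the identity bridges the two. *)
Lemma ge0_integral_normal (R : realType) (nu : {measure set R -> \bar R})
    (m s : R) (g : R -> \bar R) :
  (forall A : set R, measurable A -> nu A = normal_prob m s A) ->
  measurable_fun setT g -> (forall x, (0 <= g x)%E) ->
  (\int[nu]_x g x =
   \int[lebesgue_measure]_x (g x * (normal_pdf m s x)%:E))%E.
Proof.
move=> nuE mg g0.
rewrite -(@weighted_change_of_variables _ _ (measurableTypeR R) _ R
  lebesgue_measure nu idfun (fun x => (normal_pdf m s x)%:E))//.
- by move=> _ A mA; rewrite setTI.
- by apply/measurable_EFinP; exact: measurable_normal_pdf.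
- by move=> x; rewrite lee_fin normal_pdf_ge0.
- by move=> A mA; rewrite nuE.
Qed.

Lemma ge0_integral_comp_opp (R : realType) (f : R -> R) :
  continuous f -> (forall x, 0 <= f x) ->
  (\int[lebesgue_measure]_x (f (- x))%:E = \int[lebesgue_measure]_x (f x)%:E)%E.
Proof.
move=> cf f0.
suff E (h : R -> R) : continuous h -> (forall x, 0 <= h x) ->
    (\int[lebesgue_measure]_x (h x)%:E =
      \int[lebesgue_measure]_(x in `[0%R, +oo[) (h x)%:E +
      \int[lebesgue_measure]_(x in `[0%R, +oo[) (h (- x))%:E)%E.
  rewrite E//; last by move=> x; apply: continuous_comp; [exact: opp_continuous|exact: cf].
  rewrite [RHS]E// addeC; congr (_ + _)%E.
  by apply: eq_integral => x _; rewrite opprK.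
move=> ch h0.
have mh : measurable_fun setT h by exact: continuous_measurable_fun.
rewrite -(setUv `[0%R, +oo[%classic) ge0_integral_setU//=; last 4 first.
  exact: measurableC.
  by apply/measurable_EFinP; rewrite setUv.
  by move=> x _; rewrite lee_fin.
  exact/disj_setPCl.
congr (_ + _)%E.
rewrite setCitvr integral_itv_bndo_bndc; last exact/measurable_EFinP/measurable_funTS.
rewrite -{1}oppr0 ge0_integration_by_substitutionNy//.
exact: continuous_subspaceT.
Qed.

Lemma cvg_integral0_gauss (R : realType) :
  gauss_integral_proof.integral0_gauss x @[x --> +oo] --> (Num.sqrt pi / 2 : R).
Proof.
have : Num.sqrt (@gauss_integral_proof.integral0_gauss R x ^+ 2) @[x --> +oo]
    --> Num.sqrt (pi / 4).
  apply: continuous_cvg => //;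
    [exact: sqrt_continuous|exact: gauss_integral_proof.cvg_integral0_gauss_sqr].
rewrite sqrtrM ?pi_ge0// sqrtrV// (_ : 4 = 2 ^+ 2); last first.
  by rewrite expr2 -natrM.
rewrite sqrtr_sqr ger0_norm//.
under eq_fun do rewrite sqrtr_sqr ger0_norm ?gauss_integral_proof.integral0_gauss_ge0//.
by [].
Qed.

Lemma is_derive_integral0_gauss (R : realType) (x : R) : 0 < x ->
  is_derive x 1 (@gauss_integral_proof.integral0_gauss R) (gauss_fun x).
Proof.
move=> x0.
have [] := @continuous_FTC1_closed R gauss_fun 0 x (x + 1) _ _ x0 _.
- by rewrite ltrDl.
- apply: (integrableS _ _ (subsetT _)) => //; exact: integrableT_gauss.
- exact: continuous_gauss_fun.
by move=> H1 H2; apply: DeriveDef; [exact: H1|rewrite -derive1E; exact: H2].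
Qed.


Lemma is_derive_gauss_fun (R : realType) (x : R) :
  is_derive x 1 (@gauss_fun R) (- 2 * x * gauss_fun x).
Proof.
rewrite /gauss_fun.
have h : is_derive x 1 (fun y : R => - y ^+ 2) (- (2 * x)).
  by apply: is_derive_eq; rewrite /GRing.scale/=; ring.
have H := @is_derive1_comp R expR (fun y => - y ^+ 2) x _ _ (is_derive_expR _) h.
apply: (is_derive_eq H).
by rewrite /GRing.scale/=; ring.
Qed.

Lemma cvg_mul_gauss_fun (R : realType) (k : R) : 0 < k ->
  x * gauss_fun (k * x) @[x --> +oo] --> (0 : R).
Proof.
move=> k0.
apply: (@squeeze_cvgr _ _ _ _ (cst 0) (fun x => k ^- 2 * x^-1)).
- near=> x.
  have x0 : 0 < x by near: x; exact: nbhs_pinfty_gt.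
  rewrite mulr_ge0 ?gauss_fun_ge0 ?(ltW x0)//=.
  rewrite /gauss_fun expRN ler_pdivrMr ?expR_gt0//.
  have xE : x = k ^- 2 * x^-1 * (k * x) ^+ 2.
    by field; rewrite !gt_eqF.
  rewrite [leLHS]xE -!mulrA ler_wpM2l ?invr_ge0 ?sqr_ge0// ler_wpM2l ?invr_ge0 ?(ltW x0)//.
  apply: le_trans (expR_ge1Dx _).
  by rewrite lerDr.
- exact: cvg_cst.
- rewrite -[X in _ --> X](mulr0 (k ^- 2)); apply: cvgM; first exact: cvg_cst.
  by apply/gtr0_cvgV0; [exact: nbhs_pinfty_gt|exact: cvg_id].
Unshelve. all: end_near. Qed.

(** The antiderivative [H] comes from integrating [x * (x * exp (- (x / c)^2))]
    by parts.  Since the boundary term is part of [H], the integrand stays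
    nonnegative and the fundamental theorem of calculus applies on the whole
    half-line at once. *)
Lemma integral0y_sqr_gauss (R : realType) (c : R) : 0 < c ->
  (\int[lebesgue_measure]_(x in `[0%R, +oo[)
     (x ^+ 2 * gauss_fun (c^-1 * x))%:E = (c ^+ 3 * (Num.sqrt pi / 4))%:E)%E.
Proof.
move=> c0.
pose G := @gauss_integral_proof.integral0_gauss R.
pose H (x : R) := c ^+ 2 / 2 * (c * G (c^-1 * x) - x * gauss_fun (c^-1 * x)).
have dk (x : R) : is_derive x 1 (fun y => c^-1 * y) c^-1.
  by apply: is_derive_eq; rewrite /GRing.scale/= mulr1.
have dH (x : R) : 0 < x -> is_derive x 1 H (x ^+ 2 * gauss_fun (c^-1 * x)).
  move=> x0; rewrite /H.
  have dG : is_derive x 1 (fun y => G (c^-1 * y)) (gauss_fun (c^-1 * x) * c^-1).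
    apply: is_derive1_comp; apply: is_derive_integral0_gauss.
    by rewrite mulr_gt0 ?invr_gt0.
  have dg : is_derive x 1 (fun y => gauss_fun (c^-1 * y))
      (- 2 * (c^-1 * x) * gauss_fun (c^-1 * x) * c^-1).
    by apply: is_derive1_comp; exact: is_derive_gauss_fun.
  apply: is_derive_eq.
  rewrite /GRing.scale/=; field.
  by rewrite gt_eqF.
have G0 : G 0 = 0 by rewrite /G /gauss_integral_proof.integral0_gauss set_itv1 Rintegral_set1.
have cH : H x @[x --> 0^'+] --> H 0.
  apply: cvg_at_right_filter.
  have k0 : c^-1 * x @[x --> (0:R)] --> (0:R).
    by rewrite -[X in _ --> X](mulr0 c^-1); apply: cvgM; [exact: cvg_cst|exact: cvg_id].
  have G0' : G x @[x --> (0:R)] --> (0:R).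
    apply: (@parameterized_integral_cvg_left R 0 1 gauss_fun) => //.
    by apply: (integrableS _ _ (subsetT _)) => //; exact: integrableT_gauss.
  rewrite /H mulr0 G0.
  apply: cvgM; first exact: cvg_cst.
  apply: cvgB; first by apply: cvgM; [exact: cvg_cst|exact: (cvg_comp _ _ k0 G0')].
  apply: cvgM; first exact: cvg_id.
  exact: (cvg_comp _ _ k0 (@continuous_gauss_fun R 0)).
rewrite (@ge0_continuous_FTC2y _ _ H _ (c ^+ 3 * (Num.sqrt pi / 4))).
- rewrite -EFinB /H !mulr0 G0 mulr0 mul0r subrr mulr0 subr0//.
- by move=> x _; rewrite mulr_ge0 ?sqr_ge0 ?gauss_fun_ge0.
- apply: continuous_subspaceT => x.
  apply: cvgM; first exact: exprn_continuous.
  apply: continuous_comp; last exact: continuous_gauss_fun.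
  apply: cvgM; [exact: cvg_cst|exact: cvg_id].
- rewrite (_ : c ^+ 3 * _ = c ^+ 2 / 2 * (c * (Num.sqrt pi / 2) - 0)); last by field.
  apply: cvgM; first exact: cvg_cst.
  apply: cvgB; last by apply: cvg_mul_gauss_fun; rewrite invr_gt0.
  apply: cvgM; first exact: cvg_cst.
  apply: cvg_comp; last exact: cvg_integral0_gauss.
  apply: gt0_cvgMry => //; rewrite invr_gt0//.
- by move=> x x0; have [] := dH x x0.
- exact: cH.
- by move=> x; rewrite in_itv/= andbT => x0; rewrite derive1E; have [_ ->] := dH x x0.
Qed.

(** The Gaussian integral of width [c = sqrt (2 s^2)], doubled by parity. *)
Lemma integral_sqr_normal_pdf (R : realType) (s : R) : 0 < s ->
  (\int[lebesgue_measure]_x (x ^+ 2 * normal_pdf 0 s x)%:E = (s ^+ 2)%:E)%E.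
Proof.
move=> s0.
have c0 : 0 < Num.sqrt (s ^+ 2 *+ 2) by rewrite sqrtr_gt0 pmulrn_lgt0// exprn_gt0.
set c := Num.sqrt _ in c0.
have c2 : c ^+ 2 = s ^+ 2 *+ 2 by rewrite sqr_sqrtr// pmulrn_lge0// sqr_ge0.
have pi0 : 0 < Num.sqrt (pi : R) by rewrite sqrtr_gt0 pi_gt0.
have peakE : normal_peak s = (c * Num.sqrt pi)^-1.
  by rewrite /normal_peak -mulrnAl sqrtrM// pmulrn_lge0// sqr_ge0.
have pdfE (x : R) : normal_pdf 0 s x = normal_peak s * gauss_fun (c^-1 * x).
  rewrite normal_pdfE ?gt_eqF// /normal_fun /gauss_fun subr0 exprMn exprVn c2.
  by rewrite mulNr (mulrC (x ^+ 2)).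
have cf : continuous (fun x : R => x ^+ 2 * normal_pdf 0 s x).
  move=> x; apply: cvgM; first exact: exprn_continuous.
  by apply: continuous_normal_pdf; rewrite gt_eqF.
rewrite ge0_symfun_integralT//.
- rewrite -set_itvcy.
  under eq_integral do rewrite pdfE mulrCA EFinM.
  rewrite ge0_integralZl//=.
  + rewrite integral0y_sqr_gauss// peakE -!EFinM; congr EFin.
    have -> : s ^+ 2 = c ^+ 2 / 2 by rewrite c2 -mulr_natr mulfK.
    by field; rewrite !gt_eqF.
  + apply/measurable_EFinP/measurable_funM; first exact: measurable_funX.
    apply: measurable_funTS; apply: measurableT_comp; first exact: measurable_gauss_fun.
    exact: measurable_funM.
  + by move=> x _; rewrite lee_fin mulr_ge0 ?sqr_ge0 ?gauss_fun_ge0.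
  + by rewrite lee_fin normal_peak_ge0.
- by move=> x; rewrite mulr_ge0 ?sqr_ge0 ?normal_pdf_ge0.
- by move=> x /=; rewrite !pdfE sqrrN mulrN /gauss_fun sqrrN.
Qed.

Lemma ge0_integral_comp_opp_normal_pdf (R : realType) (s : R) (g : R -> R) :
  0 < s -> continuous g -> (forall x, 0 <= g x) ->
  (\int[lebesgue_measure]_x (g (- x) * normal_pdf 0 s x)%:E =
   \int[lebesgue_measure]_x (g x * normal_pdf 0 s x)%:E)%E.
Proof.
move=> s0 cg g0.
rewrite -[RHS](@ge0_integral_comp_opp _ (fun x => g x * normal_pdf 0 s x)).
- apply: eq_integral => x _.
  by rewrite !normal_pdfE ?gt_eqF// /normal_fun !subr0 sqrrN.
- move=> x; apply: cvgM; first exact: cg.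
  by apply: continuous_normal_pdf; rewrite gt_eqF.
- by move=> x; rewrite mulr_ge0 ?normal_pdf_ge0.
Qed.

(** In the degenerate case [s = 0] the law is a Dirac mass.  Otherwise the mean
    vanishes because the density is even; integrability of [X] comes from the
    second moment. *)
Lemma gaussian_moments d (T : measurableType d) (R : realType)
    (P : probability T R) (X : {RV P >-> R}) (s : R) : 0 <= s ->
  (forall A, measurable A -> distribution P X A = gaussian_law 0 s A) ->
  [/\ P.-integrable setT (fun w => (X w ^+ 2)%:E),
      (\int[P]_w (X w)%:E = 0)%E &
      (\int[P]_w (X w ^+ 2)%:E = (s ^+ 2)%:E)%E].
Proof.
move=> s0 distX.
have msqr : measurable_fun setT (fun x : R => (x ^+ 2)%:E).
  exact/measurable_EFinP/measurable_funX.
have mX2 : measurable_fun setT (fun w => X w ^+ 2) by exact: measurable_funX.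
have EX2 : (\int[P]_w (X w ^+ 2)%:E = (s ^+ 2)%:E)%E.
  rewrite -(@ge0_integral_distribution _ _ _ _ _ P X (fun x => (x ^+ 2)%:E))//; last first.
    by move=> x; rewrite lee_fin sqr_ge0.
  have [s00|sn0] := eqVneq s 0.
    rewrite (eq_measure_integral (dirac (0:R))); last first.
      by move=> A mA _; rewrite [LHS]distX// /gaussian_law s00 eqxx.
    by rewrite integral_dirac// diracT mul1e s00.
  have distN A : measurable A -> distribution P X A = normal_prob 0 s A.
    by move=> mA; rewrite distX// /gaussian_law (negbTE sn0).
  rewrite (ge0_integral_normal _ _ _ _ _ distN)//; last by move=> x; rewrite lee_fin sqr_ge0.
  by under eq_integral do rewrite -EFinM; rewrite integral_sqr_normal_pdf// lt_neqAle eq_sym sn0.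
have iX2 : P.-integrable setT (fun w => (X w ^+ 2)%:E).
  apply/integrableP; split; first exact/measurable_EFinP.
  under eq_integral do rewrite abse_EFin ger0_norm ?sqr_ge0//.
  by rewrite EX2 ltry.
have iX : P.-integrable setT (fun w => (X w)%:E) by exact: integrable_of_sqr.
split => //.
have [s00|sn0] := eqVneq s 0.
  rewrite -(@integral_distribution _ _ _ _ _ P X EFin)//.
  rewrite (eq_measure_integral (dirac (0:R))); last first.
    by move=> A mA _; rewrite [LHS]distX// /gaussian_law s00 eqxx.
  by rewrite integral_dirac// diracT mul1e.
(* the positive and negative parts of X have the same mean, by symmetry *)
pose gp (x : R) := Num.max x 0.
have cgp : continuous gp by move=> x; apply: continuous_max; [exact: cvg_id|exact: cvg_cst].
have gp0 x : 0 <= gp x by rewrite le_max lexx orbT.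
have mgp : measurable_fun setT gp by exact: continuous_measurable_fun.
have le_gp x : `|gp x| <= `|x|.
  by rewrite /gp; case: (leP x 0) => //; rewrite normr0.
have igp (h : R -> R) : measurable_fun setT h -> (forall x, `|h x| = `|x|) ->
    P.-integrable setT (fun w => (gp (h (X w)))%:E).
  move=> mh hx; apply: (le_integrable _ _ _ iX) => //.
    by apply/measurable_EFinP; do 2 apply: measurableT_comp => //.
  by move=> w _; rewrite lee_fin (le_trans (le_gp _))// hx.
have XE w : X w = gp (X w) - gp (- X w).
  rewrite /gp; case: (leP (X w) 0) => gx.
    by rewrite max_l ?oppr_ge0// sub0r opprK.
  by rewrite max_r ?subr0// oppr_le0 ltW.
have i1 := igp idfun (@measurable_id _ _ _) (fun x => erefl).
have i2 := igp (@GRing.opp R) (@oppr_measurable _ _) (@normrN _ _).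
under eq_integral do rewrite XE EFinB.
rewrite integralB_EFin//.
have gpE (h : R -> R) : measurable_fun setT h ->
   (\int[P]_w (gp (h (X w)))%:E =
    \int[lebesgue_measure]_x (gp (h x) * normal_pdf 0 s x)%:E)%E.
  move=> mh.
  have mgph : measurable_fun setT (fun x => (gp (h x))%:E).
    by apply/measurable_EFinP; apply: measurableT_comp.
  rewrite -(@ge0_integral_distribution _ _ _ _ _ P X (fun x => (gp (h x))%:E))//=; last first.
    by move=> x; rewrite lee_fin.
  rewrite (@ge0_integral_normal _ _ 0 s)//; first last.
  - by move=> x; rewrite lee_fin.
  - by move=> A mA; rewrite [LHS]distX// /gaussian_law (negbTE sn0).
have E1 : (\int[P]_w (gp (X w))%:E =
    \int[lebesgue_measure]_x (gp x * normal_pdf 0 s x)%:E)%E.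
  exact: (gpE idfun (@measurable_id _ _ _)).
have E2 : (\int[P]_w (gp (- X w))%:E = \int[P]_w (gp (X w))%:E)%E.
  rewrite E1 (gpE (@GRing.opp R))// ge0_integral_comp_opp_normal_pdf//.
  by rewrite lt_neqAle eq_sym sn0.
by rewrite E2 subee// integrable_fin_num.
Qed.

(** * Discrete Fourier transform of the windows *)

(** Multiplied by [2 sin (a / 2)], the sum telescopes to the increment of
    [sin (b - a / 2 + t a)] over [n] steps, which is a whole number of periods. *)
Lemma sum_cos_arith_eq0 (R : realType) (n k : nat) (a b : R) :
  sin (a / 2) != 0 -> n%:R * a = k%:R * (2 * pi) ->
  \sum_(t < n) cos (b + t%:R * a) = 0.
Proof.
move=> sa na.
suff : 2 * sin (a / 2) * \sum_(t < n) cos (b + t%:R * a) = 0.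
  by move/eqP; rewrite mulf_eq0 mulf_eq0 pnatr_eq0/= (negbTE sa) => /eqP.
pose u t := sin (b + t%:R * a - a / 2).
transitivity (\sum_(0 <= t < n) (u t.+1 - u t)).
  rewrite mulr_sumr big_mkord; apply: eq_bigr => t _; rewrite /u.
  have -> : b + t.+1%:R * a - a / 2 = (b + t%:R * a) + a / 2.
    by rewrite -natr1; field.
  by rewrite sinD sinB; ring.
rewrite telescope_sumr// /u na mul0r addr0.
have -> : b + k%:R * (2 * pi) - a / 2 = (b - a / 2) + (pi *+ 2) *+ k.
  by rewrite -mulr_natl -(mulr_natl pi); ring.
by rewrite (@periodicn _ _ sin (pi *+ 2)) ?subrr//; exact: sinD2pi.
Qed.

Lemma sin_neq0 (R : realType) (x : R) : 0 < x < 2 * pi -> x <> pi -> sin x != 0.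
Proof.
move=> /andP[x0 x2] xpi.
have [xltpi|pilex] := ltP x pi.
  by rewrite gt_eqF// sin_gt0_pi// x0.
have pix : pi < x by rewrite lt_neqAle pilex andbT; apply/eqP => /esym.
rewrite -(subrK pi x) sinDpi oppr_eq0 gt_eqF// sin_gt0_pi//.
by rewrite subr_gt0 pix/= ltrBlDl -mulr2n -mulr_natl.
Qed.

Definition phase (R : realType) (L : nat) (f : 'I_L) (t : nat) : R :=
  2 * pi * f%:R * t%:R / L%:R.

Arguments phase R {L} f t.

(** For each [s], the second harmonic has step [a = 4 pi f / L], hence sums to
    zero as soon as [sin (2 pi f / L)] is nonzero; the conditions on [f] exclude
    the only zeros [0] and [pi] of the sine in question. *)
Lemma sum_sqr_cos_phase (R : realType) (L : nat) (f : 'I_L) :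
  (f : nat) <> 0%N -> f%:R <> L%:R / 2 :> R ->
  \sum_(s < L) \sum_(t < L) cos (phase R f s - phase R f t) ^+ 2 = L%:R ^+ 2 / 2.
Proof.
move=> f0 f2.
have L0 : (0 < L%:R :> R) by rewrite ltr0n; exact: leq_ltn_trans (ltn_ord f).
have pi0 := pi_gt0 R.
have fgt0 : (0 < f%:R :> R) by rewrite ltr0n lt0n; exact/eqP.
have fltL : (f%:R < L%:R :> R) by rewrite ltr_nat.
have half (s : 'I_L) : \sum_(t < L) cos (phase R f s - phase R f t) ^+ 2 = L%:R / 2.
  pose a : R := 2 * (2 * pi * f%:R / L%:R).
  have -> : \sum_(t < L) cos (phase R f s - phase R f t) ^+ 2 =
      \sum_(t < L) (2^-1 + 2^-1 * cos (- (2 * phase R f s) + t%:R * a)).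
    apply: eq_bigr => t _.
    have -> : - (2 * phase R f s) + t%:R * a = - ((phase R f s - phase R f t) *+ 2).
      by rewrite /phase /a -mulr_natl; field; rewrite gt_eqF.
    by rewrite cosN cos_mulr2n -mulr_natl; field.
  rewrite big_split/= sumr_const card_ord -mulr_sumr (@sum_cos_arith_eq0 _ _ (2 * f)).
  - by rewrite mulr0 addr0 -[_ *+ L]mulr_natl.
  - have -> : a / 2 = 2 * pi * f%:R / L%:R by rewrite /a; field; rewrite gt_eqF.
    apply: sin_neq0.
      rewrite divr_gt0 ?mulr_gt0//= ltr_pdivrMr// ltr_pM2l//.
      by rewrite mulr_gt0.
    move=> h; apply: f2.
    have : 2 * pi * f%:R = 2 * pi * f%:R / L%:R * L%:R :> R.
      by rewrite divfK// gt_eqF.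
    rewrite h.
    rewrite -mulrA mulrCA => /(mulfI (lt0r_neq0 pi0)) <-.
    by field.
  - by rewrite /a natrM; field; rewrite gt_eqF.
under eq_bigr do rewrite half.
by rewrite sumr_const card_ord -mulr_natl expr2; ring.
Qed.

Lemma sum_complex (R : realType) (n : nat) (a b : 'I_n -> R) :
  \sum_(t < n) (a t +i* b t)%C = ((\sum_(t < n) a t) +i* (\sum_(t < n) b t))%C.
Proof.
elim: n a b => [|n IH] a b; first by rewrite !big_ord0.
by rewrite !big_ord_recl IH; simpc.
Qed.

Lemma window_dftE (R : realType) (L M : nat) (x : 'I_(L * M) -> R)
    (m : 'I_M) (f : 'I_L) :
  window_dft x m f =
  (((Num.sqrt L%:R)^-1 * (\sum_(t < L) window x m t * cos (phase R f t))) +i*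
   - ((Num.sqrt L%:R)^-1 * \sum_(t < L) window x m t * sin (phase R f t)))%C.
Proof.
rewrite /window_dft.
have -> : \sum_(t < L) (window x m t)%:C%C * expi (- (2 * pi * f%:R * t%:R / L%:R)) =
    ((\sum_(t < L) window x m t * cos (phase R f t)) +i*
     - (\sum_(t < L) window x m t * sin (phase R f t)))%C.
  rewrite -sumrN.
  rewrite (eq_bigr (fun t : 'I_L => (window x m t * cos (phase R f t) +i*
      - (window x m t * sin (phase R f t)))%C)); last first.
    move=> t _; rewrite /expi cosN sinN /phase.
    by simpc.
  by rewrite sum_complex.
by simpc.
Qed.

Lemma cross_spectrumE (R : realType) (L M : nat) (x : 'I_(L * M) -> R)
    (m m' : 'I_M) (f : 'I_L) :
  complex.Re (window_dft x m f * (window_dft x m' f)^*%C) =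
  L%:R^-1 * \sum_(s < L) \sum_(t < L)
    cos (phase R f s - phase R f t) * (window x m s * window x m' t).
Proof.
rewrite !window_dftE/=.
set c := (Num.sqrt _)^-1.
have c2 : c * c = L%:R^-1 by rewrite -invfM -expr2 sqr_sqrtr// ler0n.
set C := \sum_(_ < _) _ * cos _; set S := \sum_(_ < _) _ * sin _.
set C' := \sum_(_ < _) _ * cos _; set S' := \sum_(_ < _) _ * sin _.
have -> : c * C * (c * C') - - (c * S) * - - (c * S') = c * c * (C * C' + S * S') by ring.
rewrite c2; congr (_ * _).
rewrite /C /S !mulr_suml -big_split/=; apply: eq_bigr => s _.
rewrite /C' /S' !mulr_sumr -big_split/=; apply: eq_bigr => t _.
by rewrite cosB; ring.
Qed.

(** * The periodogram as a combination of monomials *)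

Definition sample (L M : nat) (m : 'I_M) (t : 'I_L) : 'I_(L * M) :=
  Ordinal (window_index_lt m t).

Arguments sample {L M} m t.

Lemma sample_inj (L M : nat) (m m' : 'I_M) (t t' : 'I_L) :
  sample m t = sample m' t' -> m = m' /\ t = t'.
Proof.
move=> /(congr1 val)/= e.
have L0 : (0 < L)%N by exact: leq_ltn_trans (ltn_ord t).
split; apply: val_inj => /=.
  have := congr1 (divn^~ L) e.
  by rewrite /= !divnMDl// !divn_small// !addn0.
have := congr1 (modn^~ L) e.
by rewrite /= !modnMDl !modn_small.
Qed.

Lemma ordSE (M : nat) (m : 'I_M) :
  ordS m = (if m.+1 == M then 0 else m.+1)%N :> nat.
Proof.
rewrite /=; case: eqP => [->|/eqP mM]; first by rewrite modnn.
by rewrite modn_small// ltn_neqAle mM ltn_ord.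
Qed.

Lemma ordS_neq (M : nat) (m : 'I_M) : (1 < M)%N -> ordS m != m.
Proof.
move=> M1; apply/eqP => /(congr1 (@nat_of_ord M)); rewrite ordSE.
by case: eqP; lia.
Qed.

Lemma ordS2_neq (M : nat) (m : 'I_M) : (2 < M)%N -> ordS (ordS m) != m.
Proof.
move=> M2; apply/eqP => /(congr1 (@nat_of_ord M)); rewrite ordSE ordSE.
by case: eqP; case: eqP; lia.
Qed.

Definition sample_pair (L M : nat) (p : 'I_M * ('I_L * 'I_L)) : {set 'I_(L * M)} :=
  [set sample p.1 p.2.1; sample (ordS p.1) p.2.2]%SET.

Arguments sample_pair {L M} p.

Lemma sample_pair_neq (L M : nat) (p : 'I_M * ('I_L * 'I_L)) : (1 < M)%N ->
  sample p.1 p.2.1 != sample (ordS p.1) p.2.2.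
Proof.
move=> M1; apply/eqP => /sample_inj[/esym/eqP + _].
by rewrite (negbTE (ordS_neq _ _ M1)).
Qed.

(** Equality of the two pairs either matches them in order, or crosswise, and
    then stepping twice around the cycle of windows returns to the start,
    which does not happen on a cycle of length at least [3]. *)
Lemma sample_pair_inj (L M : nat) : (2 < M)%N -> injective (@sample_pair L M).
Proof.
move=> M2 [m [s t]] [m' [s' t']] e.
have M1 : (1 < M)%N by exact: ltnW.
have : sample m s \in sample_pair (m', (s', t')) by rewrite -e !inE eqxx.
have : sample (ordS m) t \in sample_pair (m', (s', t')).
  by rewrite -e !inE eqxx orbT.
rewrite !inE/= => /orP[] /eqP/sample_inj[e1 e2] /orP[] /eqP/sample_inj[e3 e4].
- by have := ordS_neq _ m M1; rewrite e1 e3 eqxx.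
- by have := ordS2_neq _ m' M2; rewrite -e3 e1 eqxx.
- by rewrite e2 e3 e4.
- by have := ordS_neq _ m M1; rewrite e1 e3 eqxx.
Qed.

(** For [M = 1] a window would be correlated with itself, and the diagonal
    terms would be squares instead of monomials. *)
Lemma periodogramE (R : realType) (L M : nat) (x : 'I_(L * M) -> R) (f : 'I_L) :
  (1 < M)%N ->
  periodogram x f = \sum_(p : 'I_M * ('I_L * 'I_L))
    (cos (phase R f p.2.1 - phase R f p.2.2) / (M%:R * L%:R)) *
    \prod_(i in sample_pair p) x i.
Proof.
move=> M1; rewrite /periodogram mulr_sumr.
rewrite -(pair_bigA _ (fun (m : 'I_M) (st : 'I_L * 'I_L) => cos (phase R f st.1 - phase R f st.2) /
  (M%:R * L%:R) * \prod_(i in sample_pair (m, st)) x i))/=.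
apply: eq_bigr => m _; rewrite cross_spectrumE.
rewrite -(pair_bigA _ (fun s t : 'I_L => cos (phase R f s - phase R f t) /
  (M%:R * L%:R) * \prod_(i in sample_pair (m, (s, t))) x i))/=.
rewrite mulrA mulr_sumr; apply: eq_bigr => s _.
rewrite mulr_sumr; apply: eq_bigr => t _.
rewrite finset.big_setU1/=; last first.
  by rewrite inE; exact: (sample_pair_neq _ _ (m, (s, t)) M1).
rewrite finset.big_set1 -/(window x m s) -/(window x (ordS m) t).
by rewrite invfM; ring.
Qed.

Theorem theorem1 (R : realType) (d : measure_display) (T : measurableType d)
    (P : probability T R) (L M : nat) (sigma : R)
    (n : 'I_(L * M) -> {RV P >-> R}) (f : 'I_L)
    (hL : (1 <= L)%N) (hM : (3 <= M)%N) (hsigma : 0 <= sigma)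
    (hn : iid_gaussian P n 0 sigma)
    (hf0 : (f : nat) <> 0%N) (hf2 : f%:R <> L%:R / 2 :> R) :
  let Pn : T -> R := fun w => periodogram (fun t => n t w) f in
  [/\ 'E_P[Pn]%E = 0%E,
      'V_P[Pn]%E = (sigma ^+ 4 / (2 * M%:R))%:E &
      ('E_P[fun w => `|Pn w|%R] <= (sigma ^+ 2 / Num.sqrt (2 * M%:R))%:E)%E].
Proof.
move=> Pn; have [indn distn] := hn.
have M1 : (1 < M)%N by exact: ltnW.
have M0 : (0 < M%:R :> R) by rewrite ltr0n ltnW.
have L0 : (0 < L%:R :> R) by rewrite ltr0n.
pose b (p : 'I_M * ('I_L * 'I_L)) : R :=
  cos (phase R f p.2.1 - phase R f p.2.2) / (M%:R * L%:R).
have PnE : Pn = fun w => \sum_p b p * \prod_(i in sample_pair p) n i w.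
  by apply/funext => w; exact: periodogramE.
have card2 (p : 'I_M * ('I_L * 'I_L)) : #|sample_pair p| = 2%N.
  by rewrite finset.cards2 sample_pair_neq.
have [EP iP2 EP2] : [/\ (\int[P]_w (Pn w)%:E = 0)%E,
    P.-integrable setT (fun w => (Pn w ^+ 2)%:E) &
    (\int[P]_w (Pn w ^+ 2)%:E =
      (\sum_p b p ^+ 2 * (sigma ^+ 2) ^+ #|sample_pair p|)%:E)%E].
  rewrite PnE; apply: monomial_sum_moments => //.
  - by move=> i; have [] := @gaussian_moments _ _ _ _ (n i) _ hsigma (distn i).
  - by move=> i; have [] := @gaussian_moments _ _ _ _ (n i) _ hsigma (distn i).
  - by move=> i; have [] := @gaussian_moments _ _ _ _ (n i) _ hsigma (distn i).
  - exact: sample_pair_inj.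
  - by move=> p; rewrite -finset.card_gt0 card2.
have sumb : \sum_p b p ^+ 2 * (sigma ^+ 2) ^+ #|sample_pair p| =
    sigma ^+ 4 / (2 * M%:R).
  transitivity ((sigma ^+ 4 / (M%:R * L%:R) ^+ 2) *
     \sum_(p : 'I_M * ('I_L * 'I_L)) cos (phase R f p.2.1 - phase R f p.2.2) ^+ 2).
    rewrite mulr_sumr; apply: eq_bigr => p _; rewrite card2 /b -exprM.
    by rewrite exprMn exprVn; ring.
  rewrite -(pair_bigA _ (fun (m : 'I_M) (st : 'I_L * 'I_L) => cos (phase R f st.1 - phase R f st.2) ^+ 2))/=.
  rewrite sumr_const card_ord.
  rewrite -(pair_bigA _ (fun s t : 'I_L => cos (phase R f s - phase R f t) ^+ 2))/=.
  rewrite sum_sqr_cos_phase// -mulr_natl; field.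
  by rewrite !gt_eqF.
rewrite sumb in EP2.
have EPn : 'E_P[Pn]%E = 0%E by rewrite unlock.
split=> //.
  rewrite /variance unlock EPn.
  rewrite [X in 'E_P[X]%E](_ : _ = fun w => Pn w ^+ 2); first by rewrite unlock.
  by apply/funext => w; rewrite -[LHS]/((Pn w - 0) * (Pn w - 0)) subr0 expr2.
rewrite unlock; apply: L1_le_L2 => //.
- rewrite PnE; apply: measurable_sum => p; apply: measurable_funM => //.
  exact: (@measurable_prod_comp _ _ _ _ _ n (fun _ x => x)).
- by rewrite divr_ge0 ?sqr_ge0 ?sqrtr_ge0.
- rewrite EP2 expr_div_n sqr_sqrtr; last by rewrite mulr_ge0 ?ler0n.
  by rewrite -exprM.
Qed.
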